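(* Let $p\neq 0$ and $q>1$ be integers with $g:=\gcd(p,q)$, let $\bar p$ satisfy $p\bar p\equiv g \pmod q$, let $r$ be any integer, and let $\omega:=e^{2\pi i/q}$. Then $$\widehat{\mathcal B_{p,r}^q}(0)=p,$$ and for $j\not\equiv 0\pmod q$: $$\widehat{\mathcal B_{p,r}^q}(j)=\begin{cases} g\,\dfrac{1-\omega^{j}}{1-\omega^{j\bar p}}\,\omega^{-jr} & \text{if } g\mid j,\\[2mm] 0 & \text{if } g\nmid j,\end{cases} \qquad \left|\widehat{\mathcal B_{p,r}^q}(j)\right|=\begin{cases} g\left|\dfrac{\sin(\pi j/q)}{\sin(\pi j\bar p/q)}\right| & \text{if } g\mid j,\\[2mm] 0 & \text{if } g\nmid j.\end{cases}$$
   Context: For integers $p,q$ (with $p\ne 0$) and $r$, the rational Beatty set is $\mathcal B_{p,r}^q:=\{\lfloor nq/p+r\rfloor : n\in\mathbb Z\}$. It is regarded as a multiset and identified with its indicator function, so that $\mathcal B_{p,r}^q(x)$ is the multiplicity of $x$; it is periodic with period $q$ and is regarded as a function on $\mathbb Z_q$, the integers modulo $q$. The Fourier transform of a function $f$ on $\mathbb Z_q$ is $\hat f(j):=\sum_{x\in\mathbb Z_q} f(x)\,\omega^{-jx}$ with $\omega=e^{2\pi i/q}$; for the Beatty set this is written $$\widehat{\mathcal B_{p,r}^q}(j)=\sum_{n=1}^{p}\omega^{-j\lfloor nq/p+r\rfloor}.$$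
   Formalization: The value p at j=0 and the closed formula for g | j are claimed only for p>0, since both fail for negative p (e.g. p=-1, q=3, r=0, j=1: the transform is 1, the formula gives -ω); the vanishing and modulus formulas hold for all p≠0. *)

(* Defs.v *)
From HB Require Import structures.
From mathcomp Require Import all_boot all_order all_algebra finmap.
From mathcomp Require Import mathcomp_extra boolp classical_sets functions.
From mathcomp Require Import cardinality reals trigo.
From mathcomp Require Import complex.

Set Implicit Arguments.
Unset Strict Implicit.
Unset Printing Implicit Defensive.

Import Order.TTheory GRing.Theory Num.Theory.
Local Open Scope ring_scope.
Local Open Scope complex_scope.

Definition beatty_term (p q r n : int) : int :=
  Num.floor (n%:Q * q%:Q / p%:Q + r%:Q).

(* The multiset {floor (n q / p + r) : n in Z}, as the function that sends x to
   its multiplicity.  [fset_set] sends an infinite set to the empty one, but the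
   set of indices n below is finite as soon as p and q are nonzero. *)
Definition beatty (p q r x : int) : nat :=
  #|` fset_set [set n : int | beatty_term p q r n = x]%classic |.

(* e^(2 i pi / q) *)
Definition omega (R : realType) (q : nat) : R[i] :=
  cos (2 * pi / q%:R) +i* sin (2 * pi / q%:R).

(* 'Z_q is the ring of integers modulo q only for 1 < q. *)
Definition dft (R : realType) (q : nat) (f : 'Z_q -> R[i]) (j : int) : R[i] :=
  \sum_(x : 'Z_q) f x * omega R q ^ (- (j * (x : nat)%:Z)).

(* Multiplicities are q-periodic, so the representative of x in [0, q) may be
   used. *)
Definition beatty_Zq (R : realType) (p : int) (q : nat) (r : int) :
    'Z_q -> R[i] :=
  fun x => (beatty p q r (x : nat)%:Z)%:R.

Definition beatty_hat (R : realType) (p : int) (q : nat) (r j : int) : R[i] :=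
  dft (@beatty_Zq R p q r) j.

(* Main.v *)
(** For [p > 0] an index [n] has [floor (n q / p + r) = x] iff
    [n q = (x - r) p + m] with [0 <= m < p], so the multiplicity of [x] is the
    number of [m] in [[0, p)] with [q | (x - r) p + m].  The transform is
    therefore [w^(-j r)] times the sum over [m] of
    [S_m = \sum_(y mod q) [q | y p + m] w^(-j y)].  This vanishes unless
    [g | m]; for [m = g k] the substitution [y := y - k pbar] gives
    [S_m = w^(j k pbar) S_0], and [S_0], a sum over the multiples of [q / g],
    is [g] if [g | j] and [0] otherwise.  What remains is a geometric sum of
    [p / g] powers of [w^(j pbar)].  The symmetry [n -> - n] reduces a negative
    [p] to [- p]. *)
Require Import Defs.
From HB Require Import structures.
From mathcomp Require Import all_boot all_order all_algebra.
From mathcomp Require Import finmap boolp classical_sets cardinality.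
From mathcomp Require Import reals trigo complex.
From mathcomp Require Import ring zify.

Import Order.TTheory GRing.Theory Num.Theory.
Local Open Scope ring_scope.
Local Open Scope complex_scope.

(** * Multiplicities as counts of residues *)

Lemma card_fset_set_seq (T : choiceType) (A : set T) (s : seq T) :
  uniq s -> (forall x, A x <-> x \in s) -> #|` fset_set A| = size s.
Proof.
move=> us As; have -> : A = [set` seq_fset tt s]%classic.
  apply/seteqP; split=> x /=; first by move/As; rewrite -(seq_fsetE tt).
  by move/(etrans (esym (seq_fsetE tt s x)))/As.
by rewrite set_fsetK size_seq_fset undup_id.
Qed.

Lemma beatty_term_eq (p : nat) (q r n x : int) : (0 < p)%N ->
  beatty_term p q r n = x <->
  (x - r) * p%:Z <= n * q < (x - r) * p%:Z + p%:Z.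
Proof.
move=> p0; have p0' : 0 < (p%:Z)%:~R :> rat by rewrite ltr0z.
rewrite (rwP eqP) floor_eq -lerBlDr ler_pdivlMr // -ltrBrDr ltr_pdivrMr //.
rewrite -!rmorphB -!rmorphM /= ler_int ltr_int.
by have -> : (x + 1 - r) * p%:Z = (x - r) * p%:Z + p%:Z by ring.
Qed.

(** The indices are listed through the bijection between [n] and [m = n * q - (x - r) * p]. The list
    itself, and not only its length, is kept because [beatty_opp] negates its entries. *)
Lemma beatty_indices (p q : nat) (r x : int) : (0 < p)%N -> (0 < q)%N ->
  exists s : seq int, [/\ uniq s,
    forall n, beatty_term p q r n = x <-> n \in s &
    size s = (\sum_(0 <= m < p) (q %| ((x - r) * p%:Z + m%:Z)%R)%Z)%N].
Proof.
move=> p0 q0; set y : int := x - r.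
pose I := [seq m <- iota 0 p | (q %| y * p%:Z + m%:Z)%Z].
exists [seq ((y * p%:Z + m%:Z) %/ q)%Z | m : nat <- I]; split.
- rewrite map_inj_in_uniq ?filter_uniq ?iota_uniq // => m m'.
  rewrite !mem_filter => /andP[/divzK dm _] /andP[/divzK dm' _] e.
  by have := dm; rewrite e dm' => /addrI [].
- move=> n; rewrite beatty_term_eq // -/y; split=> [/andP[h1 h2]|/mapP[m]].
    apply/mapP; exists `|(n * q%:Z - y * p%:Z)%R|%N.
      rewrite mem_filter mem_iota /= gez0_abs ?subr_ge0 //.
      rewrite addrC subrK dvdz_mull //=; lia.
    by rewrite gez0_abs ?subr_ge0 // addrC subrK mulzK //; lia.
  rewrite mem_filter mem_iota /= => /andP[/divzK dm mp] ->; rewrite dm; lia.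
- by rewrite size_map size_filter -sum1_count big_mkcond /= /index_iota subn0.
Qed.

Lemma beattyE (p q : nat) (r x : int) : (0 < p)%N -> (0 < q)%N ->
  beatty p q r x = (\sum_(0 <= m < p) (q %| ((x - r) * p%:Z + m%:Z)%R)%Z)%N.
Proof.
move=> p0 q0; have [s [us sP <-]] := beatty_indices p q r x p0 q0.
exact: card_fset_set_seq.
Qed.

Lemma beatty_opp (p q : nat) (r x : int) : (0 < p)%N -> (0 < q)%N ->
  beatty (- p%:Z) q r x = beatty p q r x.
Proof.
move=> p0 q0; have [s [us sP ss]] := beatty_indices p q r x p0 q0.
rewrite beattyE // -ss -(size_map (@GRing.opp int)).
apply: card_fset_set_seq => [|n /=].
  by rewrite map_inj_uniq //; exact: oppr_inj.
have -> : (n \in map (@GRing.opp int) s) = (- n \in s).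
  by rewrite -{1}[n]opprK (mem_map oppr_inj).
rewrite -sP (_ : beatty_term (- p%:Z) q r n = beatty_term p q r (- n)) //.
by rewrite /beatty_term !rmorphN /= invrN mulrN !mulNr.
Qed.

(** * Sums over a period and over multiples *)

Lemma sum_periodic_shift (V : nmodType) (q : nat) (F : int -> V) (a : int) :
  (forall x, F (x + q%:Z) = F x) ->
  \sum_(0 <= x < q) F (x%:Z + a) = \sum_(0 <= x < q) F x%:Z.
Proof.
have step (G : int -> V) : (forall x, G (x + q%:Z) = G x) ->
    \sum_(0 <= x < q) G (x%:Z + 1) = \sum_(0 <= x < q) G x%:Z.
  case: q => [|q] Gq; first by rewrite !big_nil.
  (* By periodicity the last term on the left equals the first term on the right. *)
  rewrite big_nat_recr // big_nat_recl //= addrC; congr (_ + _).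
    by rewrite -(Gq 0) add0r intS addrC.
  by apply: eq_bigr => i _; rewrite intS addrC.
have shiftn (n : nat) (G : int -> V) : (forall x, G (x + q%:Z) = G x) ->
    \sum_(0 <= x < q) G (x%:Z + n%:Z) = \sum_(0 <= x < q) G x%:Z.
  elim: n G => [|n IH] G Gq; first by under eq_bigr do rewrite addr0.
  rewrite -(step G Gq) -(IH (fun x => G (x + 1))) => [|x].
    by apply: eq_bigr => i _; rewrite -addrA intS [1 + _]addrC.
  by rewrite addrAC Gq.
move=> Fq; case: a => n; first exact: shiftn.
(* For a negative shift, the opposite positive shift is applied to the translate of [F], which
   undoes the translation. *)
rewrite -[LHS](shiftn n.+1 (fun x => F (x + Negz n))) => [|x].
  by apply: eq_bigr => i _; rewrite NegzE addrK.
by rewrite addrAC Fq.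
Qed.

(** Cut the range into [n] blocks of length [k]: only the first index of each block is a multiple of
    [k]. *)
Lemma sum_dvdn (V : nmodType) (n k : nat) (F : nat -> V) : (0 < k)%N ->
  \sum_(0 <= i < n * k | (k %| i)%N) F i = \sum_(0 <= i < n) F (i * k)%N.
Proof.
move=> k0; rewrite big_mkcond big_nat_mul; apply: eq_bigr => i _.
rewrite big_ltn ?ltn_pmul2r // dvdn_mull //.
rewrite big_nat big1 => [|m /andP[im mi]]; first exact: addr0.
case: ifP => // /dvdnP[c mc]; move: im mi.
by rewrite mc !ltn_pmul2r // ltnS => /leq_trans h /h; rewrite ltnn.
Qed.

(** * Divisibility sums weighted by powers of a root of unity *)

(* The numerator and modulus of the theorem are [p * g] and [q * g] here, with
   [p] and [q] coprime. *)
Section RootOfUnitySums.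
Variables (F : fieldType) (w : F) (p q g : nat) (pbar : int).
Hypotheses (q0 : (0 < q)%N) (g0 : (0 < g)%N).
Hypothesis qg1 : (1 < q * g)%N.
Hypothesis cpq : coprime p q.
Hypothesis ppbar : (q%:Z %| p%:Z * pbar - 1)%Z.
Hypothesis w_prim : forall x : int, (w ^ x == 1) = ((q * g)%N%:Z %| x)%Z.

Let gz0 : g%:Z != 0. Proof. by rewrite eqz_nat -lt0n. Qed.
Let qz0 : q%:Z != 0. Proof. by rewrite eqz_nat -lt0n. Qed.

Let w_neq0 : w != 0.
Proof.
apply/eqP => w0; have := w_prim (q * g)%N%:Z.
rewrite dvdzz w0 exp0rz; case: (q * g)%N qg1 => //= n _.
by rewrite eq_sym oner_eq0.
Qed.

Let w_dvd (x : int) : ((q * g)%N%:Z %| x)%Z -> w ^ x = 1.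
Proof. by rewrite -w_prim => /eqP. Qed.

(** The sum [S_0] of the overview. *)
Let K (j : int) : F :=
  \sum_(0 <= y < q * g)
    ((q * g)%N%:Z %| y%:Z * (p * g)%N%:Z)%Z%:R * w ^ (- (j * y%:Z)).

Let dvd_pg (y : int) : ((q * g)%N%:Z %| y * (p * g)%N%:Z)%Z = (q%:Z %| y)%Z.
Proof.
rewrite !PoszM mulrA dvdz_mul2r ?gz0 //.
by rewrite mulrC Gauss_dvdzr // coprimezE /= coprime_sym.
Qed.

(** Only the multiples [y] of [q] count; there [q * g] divides [j * y], so each of the [g] terms is
    1. *)
Let K_dvd (j : int) : (g%:Z %| j)%Z -> K j = g%:R.
Proof.
move=> /dvdzP[c ->]; transitivity (\sum_(0 <= y < g * q | (q %| y)%N) (1 : F)).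
  rewrite mulnC big_mkcond; apply: eq_bigr => y _.
  rewrite dvd_pg dvdzE /=; case: ifP => qy; last by rewrite mul0r.
  rewrite mul1r w_dvd // rpredN PoszM -mulrA dvdz_mull // mulrC.
  exact: dvdz_mul.
by rewrite sum_dvdn // sumr_const_nat subn0.
Qed.

Let w_shift (j y a : int) :
  w ^ (- (j * (y + a))) = w ^ (- (j * y)) * w ^ (- (j * a)).
Proof. by rewrite -expfzDr // mulrDr opprD. Qed.

Let w_per (j x : int) :
  w ^ (- (j * (x + (q * g)%N%:Z))) = w ^ (- (j * x)).
Proof.
rewrite w_shift (w_dvd (- (j * (q * g)%N%:Z))) ?mulr1 //.
by rewrite rpredN dvdz_mull.
Qed.

Let dvd_per (a b x : int) :
  ((q * g)%N%:Z %| (x + (q * g)%N%:Z) * a + b)%Z =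
  ((q * g)%N%:Z %| x * a + b)%Z.
Proof. by rewrite mulrDl addrAC rpredDr // dvdz_mulr. Qed.

Let K_ndvd (j : int) : ~~ (g%:Z %| j)%Z -> K j = 0.
Proof.
(* Translating the index by [q], a period of the divisibility condition alone,
   multiplies the sum by [w ^ (- (j * q))], which is not [1]. *)
move=> gj; pose G (y : int) : F :=
  ((q * g)%N%:Z %| y * (p * g)%N%:Z)%Z%:R * w ^ (- (j * y)).
have GP x : G (x + (q * g)%N%:Z) = G x.
  by rewrite /G w_per -[_ * (p * g)%N%:Z]addr0 dvd_per addr0.
have := sum_periodic_shift _ (q * g)%N G q%:Z GP; rewrite -/(K j).
have -> : \sum_(0 <= x < q * g) G (x%:Z + q%:Z) = K j * w ^ (- (j * q%:Z)).
  rewrite mulr_suml; apply: eq_bigr => y _.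
  by rewrite /G w_shift mulrA !dvd_pg rpredDr // dvdzz.
move=> /eqP; rewrite -subr_eq0 -[X in _ - X]mulr1 -mulrBr mulf_eq0 subr_eq0.
rewrite w_prim rpredN PoszM [j * _]mulrC dvdz_mul2l ?qz0 // (negbTE gj) orbF.
by move/eqP.
Qed.

Lemma residue_sum (j : int) (m : nat) :
  \sum_(0 <= y < q * g)
    ((q * g)%N%:Z %| y%:Z * (p * g)%N%:Z + m%:Z)%Z%:R * w ^ (- (j * y%:Z)) =
  if (g %| m)%N then w ^ (j * pbar * (m %/ g)%N%:Z) * K j else 0.
Proof.
case: ifPn => [/dvdnP[k ->]|gm]; last first.
  (* [g] divides both the modulus and [y * (p * g)], so the divisibility condition would force it to
     divide [m]. *)
  apply: big1 => y _; case: (boolP (_ %| _)%Z) => [h|]; last by rewrite mul0r.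
  case/negP: gm; have : (g%:Z %| y%:Z * (p * g)%N%:Z + m%:Z)%Z.
    by apply: dvdz_trans h; rewrite PoszM dvdz_mull.
  by rewrite rpredDl // PoszM mulrA dvdz_mull.
pose G (y : int) : F :=
  ((q * g)%N%:Z %| y * (p * g)%N%:Z + (k * g)%N%:Z)%Z%:R * w ^ (- (j * y)).
(* Translating by [- (k * pbar)] turns [k * g] into [- k * (p * pbar - 1) * g], a multiple of
   [q * g]: the condition becomes that of [K], and the weight gains the power of [w] in the
   claim. *)
rewrite mulnK // -(sum_periodic_shift _ (q * g)%N G (- (k%:Z * pbar))) => [|x].
  rewrite mulr_sumr; apply: eq_bigr => y _; rewrite /G w_shift.
  have -> : - (j * - (k%:Z * pbar)) = j * pbar * k%:Z by ring.
  have -> : (y%:Z - k%:Z * pbar) * (p * g)%N%:Z + (k * g)%N%:Z =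
    y%:Z * (p * g)%N%:Z - k%:Z * ((p%:Z * pbar - 1) * g%:Z).
    by rewrite !PoszM; ring.
  have h : ((q * g)%N%:Z %| (p%:Z * pbar - 1) * g%:Z)%Z.
    by rewrite PoszM dvdz_mul.
  by rewrite rpredDr ?rpredN ?(dvdz_mull _ h) // mulrA mulrC.
by rewrite /G w_per dvd_per.
Qed.

(** The geometric sum stays unevaluated so that the formula also covers the case where its ratio is
    1, as for [j = 0]. *)
Lemma beatty_sum (r j : int) :
  \sum_(0 <= x < q * g)
    (\sum_(0 <= m < p * g)
       ((q * g)%N%:Z %| ((x%:Z - r) * (p * g)%N%:Z + m%:Z)%R)%Z)%N%:R *
    w ^ (- (j * x%:Z)) =
  (if (g%:Z %| j)%Z then g%:R else 0) *
    (\sum_(0 <= i < p) (w ^ (j * pbar)) ^+ i) * w ^ (- (j * r)).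
Proof.
pose G (x : int) : F :=
  (\sum_(0 <= m < p * g)
     ((q * g)%N%:Z %| (x * (p * g)%N%:Z + m%:Z)%R)%Z)%N%:R *
  w ^ (- (j * (x + r))).
transitivity (\sum_(0 <= x < q * g) G (x%:Z - r)).
  by apply: eq_bigr => x _; rewrite /G subrK.
rewrite sum_periodic_shift => [|x]; last first.
  rewrite /G addrAC w_per; congr (_%:R * _).
  by apply: eq_bigr => m _; rewrite dvd_per.
under eq_bigr do rewrite /G w_shift mulrA natr_sum mulr_suml.
rewrite -mulr_suml exchange_big /=; congr (_ * _).
under eq_bigr do rewrite residue_sum.
rewrite -big_mkcond sum_dvdn //= -mulr_suml mulrC; congr (_ * _).
  by case: ifPn => [/K_dvd|/K_ndvd].
by apply: eq_bigr => i _; rewrite mulnK // -exprz_exp.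
Qed.

(** The denominator in the theorem does not vanish, because [pbar] is invertible modulo [q]. *)
Lemma expz_pbar_neq1 (j : int) :
  (g%:Z %| j)%Z -> w ^ j != 1 -> w ^ (j * pbar) != 1.
Proof.
move=> /dvdzP[c ->]; rewrite !w_prim; apply: contra.
rewrite mulrAC !PoszM !dvdz_mul2r ?gz0 // => h.
have -> : c = p%:Z * (c * pbar) - c * (p%:Z * pbar - 1) by ring.
by rewrite rpredD ?rpredN // dvdz_mull.
Qed.

(** As [p * pbar] is 1 modulo [q] and [g] divides [j], the exponents agree modulo [q * g]. This
    produces the numerator [1 - w ^ j] from the geometric sum. *)
Lemma expz_pbar (j : int) : (g%:Z %| j)%Z -> (w ^ (j * pbar)) ^+ p = w ^ j.
Proof.
move=> /dvdzP[c ->]; rewrite exprnP exprz_exp.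
have -> : c * g%:Z * pbar * p%:Z =
  c * ((p%:Z * pbar - 1) * g%:Z) + c * g%:Z by ring.
by rewrite expfzDr // w_dvd ?mul1r // dvdz_mull // PoszM dvdz_mul.
Qed.

End RootOfUnitySums.

(** * Powers of [omega] in trigonometric form *)

Section Omega.
Variable R : realType.
Implicit Types t : R.

Definition cis t : R[i] := cos t +i* sin t.

Lemma cis0 : cis 0 = 1. Proof. by rewrite /cis cos0 sin0. Qed.

Lemma cisD t u : cis (t + u) = cis t * cis u.
Proof.
apply/eqP; rewrite eq_complex /= cosD sinD eqxx /=.
by rewrite addrC [sin t * _]mulrC [cos t * _]mulrC mulrC.
Qed.

Lemma cis_neq0 t : cis t != 0.
Proof.
apply/eqP => t0; have := cisD t (- t).
by rewrite subrr cis0 t0 mul0r => /eqP; rewrite oner_eq0.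
Qed.

Lemma cisXz t (x : int) : cis t ^ x = cis (t * x%:~R).
Proof.
have natX n : cis t ^+ n = cis (t * n%:R).
  elim: n => [|n IH]; first by rewrite mulr0 cis0.
  by rewrite exprS IH -cisD mulrSr mulrDr mulr1 addrC.
case: x => n; first exact: natX.
rewrite NegzE -exprnN natX; apply: (mulfI (cis_neq0 (t * n.+1%:R))).
by rewrite divff ?cis_neq0 // -cisD mulrNz mulrN subrr cis0.
Qed.

Lemma normr_cis t : `|cis t| = 1.
Proof. by rewrite normc_def /= cos2Dsin2 sqrtr1. Qed.

(** Half-angle formula: [(1 - cos 2t)^2 + (sin 2t)^2 = (2 sin t)^2]. *)
Lemma normr_1Bcis t : `|1 - cis (t *+ 2)| = (2 * `|sin t|)%:C.
Proof.
rewrite normc_def /= sub0r sin_mulr2n cos_mulr2n.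
rewrite (_ : _ + _ = (2 * sin t) ^+ 2); last first.
  have := cos2Dsin2 t; set c := cos t; set s := sin t => h.
  have -> : c ^+ 2 = 1 - s ^+ 2 by rewrite -h addrK.
  have -> : (- (c * s *+ 2)) ^+ 2 = c ^+ 2 * s ^+ 2 *+ 4 by ring.
  have -> : c ^+ 2 = 1 - s ^+ 2 by rewrite -h addrK.
  ring.
by rewrite sqrtr_sqr normrM ger0_norm.
Qed.

Variable q : nat.
Hypothesis q0 : (0 < q)%N.

Let qR0 : 0 < q%:R :> R. Proof. by rewrite ltr0n. Qed.

Lemma omegaXz (x : int) : omega R q ^ x = cis ((pi * x%:~R / q%:R) *+ 2).
Proof.
rewrite -/(cis _) cisXz; congr cis; rewrite -mulr_natl; ring.
Qed.

Lemma normr_1BomegaXz (x : int) :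
  `|1 - omega R q ^ x| = (2 * `|sin (pi * x%:~R / q%:R)|)%:C.
Proof. by rewrite omegaXz normr_1Bcis. Qed.

(** After reduction of [x] modulo [q], a nonzero remainder gives a half-angle strictly between 0 and
    [pi], whose sine is positive, so [1 - omega ^ x] has nonzero modulus. *)
Lemma omegaXz_eq1 (x : int) : (omega R q ^ x == 1) = (q%:Z %| x)%Z.
Proof.
have w0 : omega R q != 0 by exact: cis_neq0.
have wq : omega R q ^ q%:Z = 1.
  rewrite omegaXz (_ : pi * _ / _ = pi) ?mulfK ?gt_eqF //.
  by rewrite /cis cos2pi sin2pi.
rewrite [in LHS](divz_eq x q%:Z) expfzDr // [_ * q%:Z]mulrC.
rewrite -exprz_exp wq exp1rz mul1r.
have m0 : 0 <= (x %% q%:Z)%Z by rewrite modz_ge0 // eqz_nat -lt0n.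
have mq : (x %% q%:Z)%Z < q%:Z by rewrite ltz_pmod.
apply/eqP/dvdz_mod0P => [h|->]; last by rewrite expr0z.
have := normr_1BomegaXz (x %% q%:Z)%Z.
rewrite h subrr normr0; move: m0; rewrite le_eqVlt => /orP[/eqP //|m0].
move=> [] /esym/eqP; rewrite mulf_eq0 pnatr_eq0 /= normr_eq0 gt_eqF //.
apply: sin_gt0_pi; rewrite divr_gt0 ?mulr_gt0 ?pi_gt0 ?ltr0z //=.
by rewrite ltr_pdivrMr // ltr_pM2l ?pi_gt0 // -[q%:R]/(q%:Z%:~R) ltr_int.
Qed.

End Omega.

(** * The transform for a positive numerator, through the quotients of [p] and [q] by [g] *)

Section PositiveNumerator.
Variables (R : realType) (p q : nat) (pbar : int).
Hypotheses (p0 : (0 < p)%N) (q1 : (1 < q)%N).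
Hypothesis hpbar : (q%:Z %| p%:Z * pbar - (gcdn p q)%:Z)%Z.
Let g := gcdn p q.
Let w : R[i] := omega R q.

Let q0 : (0 < q)%N. Proof. exact: ltnW. Qed.
Let g0 : (0 < g)%N. Proof. by rewrite gcdn_gt0 p0. Qed.
Let pE : (p %/ g * g)%N = p. Proof. by rewrite divnK // dvdn_gcdl. Qed.
Let qE : (q %/ g * g)%N = q. Proof. by rewrite divnK // dvdn_gcdr. Qed.
Let q'0 : (0 < q %/ g)%N.
Proof. by rewrite divn_gt0 // dvdn_leq // dvdn_gcdr. Qed.
Let qg1 : (1 < q %/ g * g)%N. Proof. by rewrite qE. Qed.

Let coprime_quotients : coprime (p %/ g) (q %/ g).
Proof. by rewrite /coprime -(eqn_pmul2r g0) muln_gcdl pE qE mul1n. Qed.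

Let inverse_quotients : ((q %/ g)%N%:Z %| (p %/ g)%N%:Z * pbar - 1)%Z.
Proof.
have gz0 : g%:Z != 0 by rewrite eqz_nat -lt0n.
rewrite -(dvdz_mul2r gz0) -PoszM qE mulrBl mul1r mulrAC -PoszM pE.
exact: hpbar.
Qed.

Let omega_prim (x : int) : (w ^ x == 1) = ((q %/ g * g)%N%:Z %| x)%Z.
Proof. by rewrite qE omegaXz_eq1. Qed.

Lemma beatty_hatE (r j : int) :
  beatty_hat R p q r j =
  (if (g%:Z %| j)%Z then g%:R else 0) *
    (\sum_(0 <= i < p %/ g) (w ^ (j * pbar)) ^+ i) * w ^ (- (j * r)).
Proof.
have := beatty_sum _ _ _ _ _ _ q'0 g0 qg1 coprime_quotients
  inverse_quotients omega_prim r j.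
rewrite pE qE => <-.
pose G (x : nat) : R[i] := (beatty p q r x%:Z)%:R * w ^ (- (j * x%:Z)).
(* ['Z_q] is the ordinal type of size [(Zp_trunc q).+2], which is [q] because [1 < q]. *)
transitivity (\sum_(0 <= x < (Zp_trunc q).+2) G x); first by rewrite big_mkord.
by rewrite Zp_cast //; apply: eq_bigr => x _; rewrite /G beattyE.
Qed.

Lemma beatty_hat0 (r : int) : beatty_hat R p q r 0 = p%:R.
Proof.
rewrite beatty_hatE dvdz0 !mul0r oppr0 expr0z mulr1.
under eq_bigr do rewrite expr1n.
by rewrite sumr_const_nat subn0 -natrM mulnC pE.
Qed.

Lemma beatty_hat_ndvd (r j : int) :
  ~~ (g%:Z %| j)%Z -> beatty_hat R p q r j = 0.
Proof. by rewrite beatty_hatE => /negbTE ->; rewrite !mul0r. Qed.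

Lemma beatty_hat_dvd (r j : int) : ~~ (q%:Z %| j)%Z -> (g%:Z %| j)%Z ->
  beatty_hat R p q r j =
  g%:R * ((1 - w ^ j) / (1 - w ^ (j * pbar))) * w ^ (- (j * r)).
Proof.
move=> qj gj; rewrite beatty_hatE gj big_mkord; congr (_ * _ * _).
have wj : w ^ (j * pbar) != 1.
  apply: (expz_pbar_neq1 _ _ _ _ _ _ g0 inverse_quotients omega_prim) => //.
  by rewrite omegaXz_eq1.
rewrite -(expz_pbar _ _ _ _ _ _ qg1 inverse_quotients omega_prim _ gj).
apply: (canRL (mulfK _)); first by rewrite subr_eq0 eq_sym.
by rewrite -[RHS]opprB subrX1 -mulNr opprB mulrC.
Qed.

Lemma norm_beatty_hat (r j : int) : ~~ (q%:Z %| j)%Z ->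
  `|beatty_hat R p q r j| =
  if (g%:Z %| j)%Z
  then (g%:R * `|sin (pi * j%:~R / q%:R) / sin (pi * (j * pbar)%:~R / q%:R)|)%:C
  else 0.
Proof.
move=> qj; case: ifPn => [gj|gj]; last by rewrite beatty_hat_ndvd // normr0.
rewrite beatty_hat_dvd // 2!normrM normf_div !normr_1BomegaXz.
rewrite [w ^ (- _)]omegaXz normr_cis mulr1 normr_nat.
(* The factor 2 cancels between the two chord lengths. *)
rewrite -(fmorph_div (real_complex R)) -mulf_div divff ?pnatr_eq0 // mul1r.
by rewrite -normf_div [in RHS]rmorphM rmorph_nat.
Qed.

End PositiveNumerator.

(** For [p < 0] the multiplicities are those of [- p], so the value at 0 is [- p]; and [- pbar]
    takes the place of [pbar], which changes the closed formula but not its modulus. Hence the two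
    restrictions to [0 < p]. *)
Theorem theorem1p1 (R : realType) (p : int) (q : nat) (r pbar : int)
    (hp : p != 0) (hq : (1 < q)%N)
    (hpbar : (p * pbar = gcdz p q %[mod q])%Z) :
  let g : int := gcdz p q in
  let w : R[i] := omega R q in
  (0 < p -> beatty_hat R p q r 0 = p%:~R) /\
  (forall j : int, (j != 0 %[mod q])%Z ->
    [/\ (g %| j)%Z -> 0 < p ->
          beatty_hat R p q r j =
            g%:~R * ((1 - w ^ j) / (1 - w ^ (j * pbar))) * w ^ (- (j * r)),
        ~~ (g %| j)%Z -> beatty_hat R p q r j = 0
      & `|beatty_hat R p q r j| =
          if (g %| j)%Z
          then (g%:~R * `|sin (pi * j%:~R / q%:R)
                          / sin (pi * (j * pbar)%:~R / q%:R)|)%:C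
          else 0]).
Proof.
move=> g w; rewrite {}/g {}/w; move/eqP: hpbar; rewrite eqz_mod_dvd.
have [p' p'0 [->|->]] : exists2 p' : nat, (0 < p')%N & p = p'%:Z \/ p = - p'%:Z.
  exists `|p|%N; first by rewrite absz_gt0.
  by case: p {hp} => n; [left|right]; rewrite ?NegzE.
- move=> h; split=> [_|j]; first exact: (beatty_hat0 _ _ _ _ p'0 hq h).
  rewrite eqz_mod_dvd subr0 => qj; split=> [gj _|gj|].
  + exact: (beatty_hat_dvd _ _ _ _ p'0 hq h).
  + exact: (beatty_hat_ndvd _ _ _ _ p'0 hq h).
  + exact: (norm_beatty_hat _ _ _ _ p'0 hq h).
(* The sign moves onto [pbar]: [p' * (- pbar)] is congruent to the gcd, so the positive case applies
   with [- pbar]. *)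
rewrite mulNr -mulrN /gcdz abszN !absz_nat => h.
have p'N : (0 < - p'%:Z :> int) = false by rewrite oppr_gt0 ltz_nat.
have hatN j : beatty_hat R (- p'%:Z) q r j = beatty_hat R p'%:Z q r j.
  by apply: eq_bigr => x _; rewrite /beatty_Zq beatty_opp // ltnW.
rewrite p'N; split=> // j.
rewrite eqz_mod_dvd subr0 hatN => qj; split=> // [gj|].
  exact: (beatty_hat_ndvd _ _ _ _ p'0 hq h).
rewrite (norm_beatty_hat _ _ _ _ p'0 hq h) //.
(* The sine is odd, so the absolute value forgets the sign of [pbar]. *)
by rewrite mulrN rmorphN /= mulrN mulNr sinN invrN mulrN normrN.
Qed.
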